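(* Let $V\subseteq k[x]$ be a $k$-linear subspace containing the ideal $I=(f_1(x_1),\dots,f_n(x_n))$. Let $\Lambda_0=\{\lambda\in\Lambda : g_\lambda\in V\}$, and for each $\Lambda'\subseteq\Lambda$ put $I(\Lambda')=\sum_{\lambda\in\Lambda'}g_\lambda$ if $\Lambda'\ne\emptyset$ and $I(\Lambda')=0$ otherwise. Then $V$ is an MZ-space of $k[x]$ if and only if for each non-empty subset $\Lambda'$ of $\Lambda$ the following conditions hold: (i) $I(\Lambda'\setminus\Lambda_0)\notin V$, if $\Lambda'\setminus\Lambda_0\ne\emptyset$; (ii) $k[x]\cdot I(\Lambda'\cap\Lambda_0)\subseteq V$.
   Context: $k$ is an algebraically closed field of characteristic zero and $k[x]=k[x_1,\dots,x_n]$ is the polynomial ring in $n$ variables. MZ-space: for a $k$-algebra $R$, a $k$-linear subspace $M\subseteq R$ is a (left) MZ-space (Mathieu-Zhao space) of $R$ if: whenever $a\in R$ is such that $a^m\in M$ for all large $m$ (i.e. there is $N$ with $a^m\in M$ for all $m\ge N$), then for every $b\in R$ also $ba^m\in M$ for all large $m$. For each $i=1,\dots,n$, $f_i(x_i)\in k[x_i]$ is a monic univariate polynomial of positive degree $d_i$, $\Lambda_i\subset k$ is the set of distinct zeros of $f_i$, and for $\lambda_i\in\Lambda_i$, $m(\lambda_i)$ is its multiplicity, so $f_i(x_i)=\prod_{\lambda_i\in\Lambda_i}(x_i-\lambda_i)^{m(\lambda_i)}$. It is assumed that $0\notin\Lambda_i$ for all $i$. Put $\Lambda=\Lambda_1\times\cdots\times\Lambda_n$,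 and for $\lambda=(\lambda_1,\dots,\lambda_n)\in\Lambda$ put $m(\lambda)=(m(\lambda_1),\dots,m(\lambda_n))$ and $[(x-\lambda)]^{m(\lambda)}=((x_1-\lambda_1)^{m(\lambda_1)},\dots,(x_n-\lambda_n)^{m(\lambda_n)})$, an ideal of $k[x]$. By the Chinese remainder theorem $k[x]/I\simeq\prod_{\lambda\in\Lambda}k[x]/[(x-\lambda)]^{m(\lambda)}$. For each $\lambda\in\Lambda$, $g_\lambda\in k[x]$ is a fixed polynomial whose class $g_\lambda+I$ corresponds to the idempotent with $1$ in the component indexed by $\lambda$ and $0$ elsewhere; that is, $g_\lambda\equiv 1 \bmod [(x-\lambda)]^{m(\lambda)}$ and $g_\lambda\in[(x-\mu)]^{m(\mu)}$ for all $\mu\in\Lambda$, $\mu\ne\lambda$. *)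

(* Defs.v *)
From mathcomp Require Import all_boot all_algebra finmap.
From mathcomp Require Import boolp classical_sets.
From mathcomp Require Import mpoly.

Set Implicit Arguments.
Unset Strict Implicit.
Unset Printing Implicit Defensive.

Import GRing.Theory.
Local Open Scope ring_scope.
Local Open Scope classical_set_scope.

(* The algebra is not assumed commutative, hence "left". *)
Definition MZ_space (k : fieldType) (R : algType k) (M : set R) : Prop :=
  GRing.submod_closed (mem M) /\
  forall a : R, (exists N, forall m, (N <= m)%N -> a ^+ m \in M) ->
    forall b : R, exists N, forall m, (N <= m)%N -> b * a ^+ m \in M.

Definition ideal_span (R : comNzRingType) (n : nat) (h : 'I_n -> R) : set R :=
  [set p | exists c : 'I_n -> R, p = \sum_(i < n) c i * h i].

Section CofiniteIdeal.

Variables (k : fieldType) (n : nat).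

Definition univ_at (i : 'I_n) (p : {poly k}) : {mpoly k[n]} :=
  (map_poly (@mpolyC n k) p).['X_i].

Variable f : 'I_n -> {poly k}.

Definition univ_ideal : set {mpoly k[n]} :=
  ideal_span (fun i => univ_at i (f i)).

Definition zeros : pred {ffun 'I_n -> k} :=
  [pred l : {ffun 'I_n -> k} | [forall i, root (f i) (l i)]].

Definition local_ideal (l : {ffun 'I_n -> k}) : set {mpoly k[n]} :=
  ideal_span (fun i => ('X_i - (l i)%:MP) ^+ mup (l i) (f i)).

(* [g l + univ_ideal] is the idempotent which the Chinese remainder
   isomorphism sends to 1 in the component of [l] and to 0 in all others. *)
Definition idempotent_reps (g : {ffun 'I_n -> k} -> {mpoly k[n]}) : Prop :=
  forall l, l \in zeros ->
    g l - 1 \in local_ideal l /\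
    (forall u, u \in zeros -> u != l -> g l \in local_ideal u).

Definition zeros_in (g : {ffun 'I_n -> k} -> {mpoly k[n]})
    (V : set {mpoly k[n]}) : pred {ffun 'I_n -> k} :=
  [pred l | (l \in zeros) && (g l \in V)].

End CofiniteIdeal.

Definition idempotent_sum (k : fieldType) (n : nat)
    (g : {ffun 'I_n -> k} -> {mpoly k[n]}) (L : {fset {ffun 'I_n -> k}}) :
    {mpoly k[n]} :=
  \sum_(l <- L) g l.

(* Main.v *)
(* Idempotents of k[x]/I are the sums of the g_l over sets S of zeros. If
   a^m lies in V for all large m and S is the set of zeros l with a(l) <> 0,
   then modulo I the element a is invertible on the components in S and nilpotent
   on the others, so e_S = sum_{l in S} g_l is a combination of large powers of a
   and hence lies in V, while b a^m = b a^m e_S for large m. Thus V is an MZ-space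
   iff the ideal generated by every idempotent in V lies in V, and the two
   conditions say exactly this. *)
Require Import Defs.
From mathcomp Require Import all_boot all_algebra finmap.
From mathcomp Require Import boolp classical_sets.
From mathcomp Require Import mpoly.

Set Implicit Arguments.
Unset Strict Implicit.
Unset Printing Implicit Defensive.

Import GRing.Theory.
Local Open Scope ring_scope.

(** * Ideals, radicals and generated ideals *)

Definition is_ideal (R : comNzRingType) (K : set R) : Prop :=
  [/\ K 0, forall p q, K p -> K q -> K (p + q) & forall p q, K q -> K (p * q)].

Section Ideals.

Variables (R : comNzRingType) (K : set R).
Hypothesis K_ideal : is_ideal K.

Lemma ideal0 : K 0. Proof. by case: K_ideal. Qed.

Lemma idealD p q : K p -> K q -> K (p + q).
Proof. by case: K_ideal => _ + _; apply. Qed.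

Lemma idealMl p q : K q -> K (p * q).
Proof. by case: K_ideal => _ _; apply. Qed.

Lemma idealMr p q : K p -> K (p * q).
Proof. by rewrite mulrC; apply: idealMl. Qed.

Lemma idealB p q : K p -> K q -> K (p - q).
Proof. by move=> Kp Kq; rewrite -mulN1r; apply: idealD => //; apply: idealMl. Qed.

Lemma ideal_sum (I : eqType) (r : seq I) (P : pred I) (F : I -> R) :
  (forall i, i \in r -> P i -> K (F i)) -> K (\sum_(i <- r | P i) F i).
Proof.
move=> KF; rewrite big_seq_cond.
elim/big_rec: _ => [|i x /andP[ir Pi] Kx]; first exact: ideal0.
by apply: idealD => //; apply: KF.
Qed.

Lemma idealX_leq p m m' : (m <= m')%N -> K (p ^+ m) -> K (p ^+ m').
Proof. by move=> le_mm' Kpm; rewrite -(subnK le_mm') exprD; apply: idealMl. Qed.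

(** In the expansion of [(p + q) ^+ (M + N)] each term has [q] to exponent at least [N] or [p] to
    exponent at least [M]. *)
Lemma radical_ideal : is_ideal [set p | exists m, K (p ^+ m)]%classic.
Proof.
split=> [|p q [M KpM] [N KqN]|p q [N KqN]] /=.
- by exists 1%N; rewrite expr1; apply: ideal0.
- exists (M + N)%N; rewrite exprDn; apply: ideal_sum => i _ _.
  rewrite -mulr_natl; apply: idealMl.
  have [le_Ni|lt_iN] := leqP N i.
    by apply: idealMl; apply: idealX_leq KqN.
  by apply: idealMr; apply: idealX_leq KpM; rewrite -addnBA ?leq_addr // ltnW.
- by exists N; rewrite exprMn; apply: idealMl.
Qed.

End Ideals.

Lemma ideal_span_ideal (R : comNzRingType) n (h : 'I_n -> R) :
  is_ideal (ideal_span h).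
Proof.
split=> [|_ _ [c ->] [c' ->]|p _ [c ->]].
- by exists (fun=> 0); rewrite big1 // => i _; rewrite mul0r.
- exists (fun i => c i + c' i); rewrite -big_split.
  by apply: eq_bigr => i _; rewrite mulrDl.
- exists (fun i => p * c i); rewrite mulr_sumr.
  by apply: eq_bigr => i _; rewrite mulrA.
Qed.

Lemma ideal_span_gen (R : comNzRingType) n (h : 'I_n -> R) i :
  ideal_span h (h i).
Proof.
exists (fun j => (j == i)%:R); rewrite (bigD1 i) //= eqxx mul1r big1 ?addr0 //.
by move=> j /negPf->; rewrite mul0r.
Qed.

(* The gcd of two elements of the ideal stays in the ideal; intersecting the
   zeros of [p] with those of suitable [q]'s eventually leaves a unit. *)
Lemma univariate_nullstellensatz (k : closedFieldType) (W : set {poly k}) p :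
  is_ideal W -> W p -> p != 0 ->
  (forall r, root p r -> exists2 q, W q & ~~ root q r) -> W 1.
Proof.
move=> W_ideal; have [s] := ubnP (size p); elim: s => // s IHs in p *.
rewrite ltnS => le_ps Wp p_neq0 Wroot.
have [/eqP/size_poly1P[c c_neq0 def_p]|/closed_rootP[r pr0]] := eqVneq (size p) 1%N.
  have -> : 1 = (c^-1)%:P * p by rewrite def_p -polyCM mulVf.
  exact: idealMl.
have [q Wq qr] := Wroot r pr0.
have [u /eqpP[[c1 c2] /andP[/= c1_neq0 c2_neq0] def_gcd]] := Bezoutp p q.
apply: (IHs (gcdp p q)).
(* The size drops strictly: otherwise the gcd is associate to [p], so [p] divides [q] and [r] is a
   root of [q]. *)
- apply: leq_trans le_ps; rewrite ltnNge; apply: contra qr => le_pg.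
  have /eqp_dvdl g_p : gcdp p q %= p.
    by rewrite -dvdp_size_eqp ?dvdp_gcdl // eqn_leq le_pg dvdp_leq ?dvdp_gcdl.
  have /dvdpP[c ->] : p %| q by rewrite -g_p dvdp_gcdr.
  by rewrite rootM pr0 orbT.
- have -> : gcdp p q = (c2^-1)%:P * (c1%:P * (u.1 * p + u.2 * q)).
    by rewrite !mul_polyC def_gcd scalerA mulVf // scale1r.
  by do 2!apply: idealMl => //; apply: idealD => //; apply: idealMl.
- by rewrite gcdp_eq0 negb_and p_neq0.
- by move=> t; rewrite root_gcd => /andP[/Wroot].
Qed.

(** * Chinese remainder theorem for the zeros of [f] *)

Section ChineseRemainder.

Variables (k : closedFieldType) (n : nat) (f : 'I_n -> {poly k}).
Hypotheses (f_monic : forall i, f i \is monic).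

Local Notation cofactor i r := (univ_at i (f i %/ ('X - r%:P) ^+ mup r (f i))).

Lemma univ_atM i p q : univ_at i (p * q) = @univ_at k n i p * univ_at i q.
Proof. by rewrite /univ_at rmorphM hornerM. Qed.

Lemma univ_atD i p q : univ_at i (p + q) = @univ_at k n i p + univ_at i q.
Proof. by rewrite /univ_at rmorphD hornerD. Qed.

Lemma univ_at1 i : @univ_at k n i 1 = 1.
Proof. by rewrite /univ_at rmorph1 hornerC. Qed.

Lemma univ_at_XsubCX i r m :
  @univ_at k n i (('X - r%:P) ^+ m) = ('X_i - r%:MP) ^+ m.
Proof.
by rewrite /univ_at rmorphXn rmorphB /= map_polyX map_polyC horner_exp !hornerE.
Qed.

Lemma mup_dvdp i r : ('X - r%:P) ^+ mup r (f i) %| f i.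
Proof. by rewrite -mup_geq // monic_neq0. Qed.

(** Cofactors turn the generators of a local ideal into those of [univ_ideal]. *)
Lemma cofactorK i r :
  cofactor i r * ('X_i - r%:MP) ^+ mup r (f i) = @univ_at k n i (f i).
Proof. by rewrite -univ_at_XsubCX -univ_atM divpK ?mup_dvdp. Qed.

(** The [q] with [univ_at i q * p] in [K] form an ideal; it contains [f i] and, for each root of
    [f i], a cofactor not vanishing there, hence 1. *)
Lemma colon_cofactors (K : set {mpoly k[n]}) i p : is_ideal K ->
  K (univ_at i (f i)) -> (forall r, root (f i) r -> K (cofactor i r * p)) -> K p.
Proof.
move=> K_ideal Kf Kp.
pose W := [set q | K (univ_at i q * p)]%classic.
suff: W 1 by rewrite /W /= univ_at1 mul1r.
apply: (@univariate_nullstellensatz _ W (f i)); rewrite /W /=.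
- split=> [|q q' Kq Kq'|q q' Kq'] /=.
  + by rewrite /univ_at rmorph0 horner0 mul0r; apply: ideal0.
  + by rewrite univ_atD mulrDl; apply: idealD.
  + by rewrite univ_atM -mulrA; apply: idealMl.
- exact: idealMr.
- exact: monic_neq0.
- move=> r fr0; exists (f i %/ ('X - r%:P) ^+ mup r (f i)); first exact: Kp.
  have := leqnn (mup r (f i)).
  rewrite (mup_leq _ _ (monic_neq0 (f_monic i))); apply: contra => /factor_theorem[q def_q].
  apply/dvdpP; exists q.
  by rewrite exprS mulrA -def_q divpK ?mup_dvdp.
Qed.

Lemma zerosP (l : {ffun 'I_n -> k}) :
  reflect (forall i, root (f i) (l i)) (l \in zeros f).
Proof. exact: forallP. Qed.

(** Injectivity in the Chinese remainder theorem. Multiplying [p] by the cofactors at all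
    coordinates of a zero lands in [univ_ideal]; [colon_cofactors] then strips them off one variable
    at a time. *)
Lemma bigcap_local_ideal p : (forall i, (1 < size (f i))%N) ->
  (forall l, l \in zeros f -> local_ideal f l p) -> univ_ideal f p.
Proof.
move=> f_deg loc_p; have I_ideal : is_ideal (univ_ideal f) by apply: ideal_span_ideal.
have If i : univ_ideal f (univ_at i (f i)) by apply: (@ideal_span_gen _ _ (fun i => _)).
(* A zero is needed to instantiate the hypothesis once no cofactor is left. *)
have [l l0] : exists l, l \in zeros f.
  have ex_root i : exists r, root (f i) r.
    by apply/closed_rootP; rewrite gtn_eqF.
  exists [ffun i => xchoose (ex_root i)].
  by apply/zerosP => i; rewrite ffunE; apply: xchooseP.
have H (s : seq 'I_n) : uniq s ->
    (forall l, l \in zeros f ->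
       univ_ideal f (\prod_(i <- s) cofactor i (l i) * p)) -> univ_ideal f p.
  elim: s => [_ /(_ l l0)|i s IHs /= /andP[i_s s_uniq] Ip]; first by rewrite big_nil mul1r.
  apply: IHs => // {l0}l l0; apply: (colon_cofactors (i := i)) => // r r0.
  (* Move the [i]-th coordinate of [l] to [r]; the other cofactors stay, since [i] is not in [s]. *)
  have := Ip [ffun j => if j == i then r else l j].
  rewrite big_cons ffunE eqxx -mulrA.
  under eq_big_seq => j js.
    rewrite ffunE; have /negPf-> : j != i by apply: contraNneq i_s => <-.
    over.
  apply; apply/zerosP => j; rewrite ffunE; case: eqP => [->//|_].
  exact: (zerosP l l0).
apply: (H (index_enum 'I_n)) => [|{l0}l l0]; first exact: index_enum_uniq.
have [c ->] := loc_p l l0; rewrite mulr_sumr; apply: ideal_sum => // i _ _.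
by rewrite (bigD1 i) //= [c i * _]mulrC mulrACA cofactorK; apply: idealMr.
Qed.

Lemma local_ideal_ideal l : is_ideal (local_ideal f l).
Proof. exact: ideal_span_ideal. Qed.

(** The polynomials congruent to their value at [l] modulo the radical of the local ideal include
    constants and variables and are closed under sums and products. *)
Lemma local_ideal_radical (l : {ffun 'I_n -> k}) (a : {mpoly k[n]}) :
  exists m, local_ideal f l ((a - a.@[l]%:MP) ^+ m).
Proof.
set Q := [set p | exists m, local_ideal f l (p ^+ m)]%classic.
have Q_ideal : is_ideal Q by apply/radical_ideal/local_ideal_ideal.
suff: Q (a - a.@[l]%:MP) by [].
have QM p q : Q (p - p.@[l]%:MP) -> Q (q - q.@[l]%:MP) ->
    Q (p * q - (p * q).@[l]%:MP).
  move=> Qp Qq; rewrite rmorphM mpolyCM.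
  have -> : p * q - p.@[l]%:MP * q.@[l]%:MP =
      p * (q - q.@[l]%:MP) + (p - p.@[l]%:MP) * q.@[l]%:MP.
    by rewrite mulrBr mulrBl addrA subrK.
  by apply: idealD => //; [apply: idealMl | apply: idealMr].
have Q1 : Q (1 - 1.@[l]%:MP) by rewrite rmorph1 mpolyC1 subrr; apply: ideal0.
elim/mpolyind: a => [|c m p _ _ Qp].
  by rewrite meval0 mpolyC0 subrr; apply: ideal0.
rewrite rmorphD mpolyCD opprD addrACA; apply: idealD => //.
rewrite /= mevalZ mpolyCM -mul_mpolyC -mulrBr; apply: idealMl => //.
rewrite mpolyXE_id; elim/big_rec: _ => [|i p' _ Qp']; first exact: Q1.
apply: (QM _ _ _ Qp'); elim: (m i) => [|d IHd]; first exact: Q1.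
rewrite exprS; apply: QM => //; rewrite mevalXU.
by exists (mup (l i) (f i)); apply: (@ideal_span_gen _ _ (fun i => _)).
Qed.

(** The type of [l] need not be finite, so all roots of all [f i] are collected in a finite type
    [J], and the functions into [J] are listed. *)
Lemma zeros_fset : exists Z : {fset {ffun 'I_n -> k}}, Z =i zeros f.
Proof.
pose rts i := sval (closed_field_poly_normal (f i)).
have root_rts i r : root (f i) r = (r \in rts i).
  rewrite /rts; case: closed_field_poly_normal => s /= {1}->.
  by rewrite (monicP (f_monic i)) scale1r root_prod_XsubC.
pose J := seq_sub (flatten [seq rts i | i <- enum 'I_n]).
exists [fset l in [seq [ffun i => val (h i)] | h : {ffun _ -> J} <- enum {ffun 'I_n -> J}]
  | l \in zeros f]%fset.
move=> l; rewrite in_fset /=; apply: andb_idl => /zerosP l0; apply/mapP.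
have lJ i : l i \in flatten [seq rts i | i <- enum 'I_n].
  by apply/flatten_mapP; exists i; rewrite ?mem_enum // -root_rts.
by exists [ffun i => SeqSub (lJ i)]; rewrite ?mem_enum //; apply/ffunP => i; rewrite !ffunE.
Qed.

End ChineseRemainder.

(** * Idempotent sums modulo [univ_ideal] *)

Section IdempotentSums.

Variables (k : closedFieldType) (n : nat) (f : 'I_n -> {poly k}).
Variable g : {ffun 'I_n -> k} -> {mpoly k[n]}.
Hypotheses (f_monic : forall i, f i \is monic)
  (f_deg : forall i, (1 < size (f i))%N) (g_idem : idempotent_reps f g).
Variable S : {fset {ffun 'I_n -> k}}.
Hypothesis S_zeros : {subset S <= zeros f}.

(** Modulo the local ideal at [u], every [g l] with [l != u] vanishes and [g u] is 1. *)
Lemma idempotent_sum_local u : u \in zeros f ->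
  local_ideal f u (idempotent_sum g S - (u \in S)%:R).
Proof.
move=> u0; have J_ideal := local_ideal_ideal f u.
have g_local l : l \in S -> l != u -> local_ideal f u (g l).
  move=> lS l_neq_u; have [_ gl] := g_idem (S_zeros lS).
  by have := gl u u0; rewrite in_setE; apply; rewrite eq_sym.
rewrite /idempotent_sum; have [uS|uS] := boolP (u \in S).
  rewrite (big_fsetD1 u) //= addrAC; apply: idealD => //.
    by have [+ _] := g_idem u0; rewrite in_setE.
  by apply: ideal_sum => // l /fsetD1P[l_neq_u lS] _; apply: g_local.
rewrite subr0; apply: ideal_sum => // l lS _; apply: g_local => //.
by apply: contraNneq uS => <-.
Qed.

(** Compare components: on [S] the sum is 1, and off [S] both terms vanish. *)
Lemma mul_idempotent_sum p :
    (forall u, u \in zeros f -> u \notin S -> local_ideal f u p) ->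
  univ_ideal f (p - p * idempotent_sum g S).
Proof.
move=> p_local; apply: bigcap_local_ideal => // u u0.
have J_ideal := local_ideal_ideal f u.
have [uS|uS] := boolP (u \in S).
  have := idempotent_sum_local u0; rewrite uS => /(idealMl J_ideal (- p)).
  by rewrite mulNr mulrBr mulr1 opprB.
have Jp := p_local u u0 uS.
by apply: idealB => //; apply: idealMr.
Qed.

Lemma idempotent_sumX m :
  univ_ideal f (idempotent_sum g S ^+ m.+1 - idempotent_sum g S).
Proof.
set e := idempotent_sum g S; have I_ideal : is_ideal (univ_ideal f) by apply: ideal_span_ideal.
elim: m => [|m IHm]; first by rewrite expr1 subrr; apply: ideal0.
rewrite -[_ - e](subrKA (e ^+ m.+1)); apply: idealD => //.
rewrite -opprB -sub0r; apply: idealB => //; first exact: ideal0.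
rewrite [e ^+ m.+2]exprSr; apply: mul_idempotent_sum => u u0 uS.
rewrite exprS; apply: idealMr; first exact: local_ideal_ideal.
by have := idempotent_sum_local u0; rewrite (negPf uS) subr0.
Qed.

End IdempotentSums.

(** * Recovering an idempotent from large powers of an element *)

Lemma horner_alg_mulXn (k : fieldType) (A : algType k) (V : set A) (a : A) N u :
  GRing.submod_closed (mem V) -> (forall m, (N <= m)%N -> a ^+ m \in V) ->
  horner_alg a (u * 'X^N) \in V.
Proof.
move=> [V0 V_lin] Va.
elim/poly_ind: u N Va => [|u c IHu] N Va; first by rewrite mul0r rmorph0.
rewrite mulrDl -mulrA -exprS addrC rmorphD rmorphM rmorphXn /=.
rewrite horner_algC horner_algX mulr_algl; apply: V_lin; first exact: Va.
by apply: IHu => m lt_Nm; apply/Va/ltnW.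
Qed.

(* [idempotent_sum g S] is congruent to a polynomial in [a] divisible by [a ^+ N]:
   Bezout for ['X^N] and a power of [\prod_(l in S) ('X - a(l))]. *)
Lemma idempotent_sum_powers (k : closedFieldType) n (f : 'I_n -> {poly k})
    (g : {ffun 'I_n -> k} -> {mpoly k[n]}) (S : {fset {ffun 'I_n -> k}})
    (a : {mpoly k[n]}) N :
  (forall i, f i \is monic) -> (forall i, (1 < size (f i))%N) ->
  idempotent_reps f g ->
  (forall l, (l \in S) = (l \in zeros f) && (a.@[l] != 0)) ->
  (forall l, l \in zeros f -> local_ideal f l ((a - a.@[l]%:MP) ^+ N)) ->
  exists u : {poly k},
    univ_ideal f (horner_alg a (u * 'X^N) - idempotent_sum g S).
Proof.
move=> f_monic f_deg g_idem S_def N_local.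
have S_zeros : {subset S <= zeros f} by move=> l; rewrite S_def => /andP[].
pose p := \prod_(l <- S) ('X - (a.@[l])%:P) ^+ N.
have : coprimep p 'X^N.
  rewrite coprimep_expr // coprimepX rootE horner_prod prodf_seq_neq0.
  apply/allP => l; rewrite S_def => /andP[_ al_neq0].
  rewrite /= horner_exp !hornerE.
  by rewrite expf_neq0 // oppr_eq0.
move=> /Bezout_eq1_coprimepP[[v u] /= def1]; exists u.
apply: bigcap_local_ideal => // l l0; have J_ideal := local_ideal_ideal f l.
have /(congr1 (horner_alg a)) := def1; rewrite rmorphD rmorph1 => def1a.
have el := idempotent_sum_local g_idem S_zeros l0.
have al := N_local l l0; have [lS|lS] := boolP (l \in S); last first.
  (* Off [S] the value of [a] at [l] is 0, so [a ^+ N] itself is in the local ideal. *)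
  rewrite (negPf lS) subr0 in el; apply: idealB => //.
  move: lS; rewrite S_def l0 /= negbK => /eqP al0; rewrite al0 subr0 in al.
  by rewrite rmorphM rmorphXn /= horner_algX; apply: idealMl.
(* On [S], [1 - u * 'X^N] equals [v * p], and [p] has the factor whose value at [a] is locally
   zero. *)
rewrite lS in el; rewrite -[_ - _](subrKA 1); apply: idealD => //; last first.
  by rewrite -opprB -sub0r; apply: idealB => //; apply: ideal0.
rewrite -def1a opprD addrCA subrr addr0 -sub0r; apply: idealB => //.
  exact: ideal0.
rewrite rmorphM; apply: idealMl => //.
rewrite /p (big_fsetD1 l) //= rmorphM; apply: idealMr => //.
rewrite rmorphXn rmorphB /= horner_algX horner_algC.
by rewrite -mul_mpolyC mulr1.
Qed.

Lemma uniform_radical_exponent (k : closedFieldType) n (f : 'I_n -> {poly k})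
    (a : {mpoly k[n]}) (Z : {fset {ffun 'I_n -> k}}) :
  exists M, forall l m, l \in Z -> (M <= m)%N ->
    local_ideal f l ((a - a.@[l]%:MP) ^+ m).
Proof.
pose e l := sval (cid (local_ideal_radical f l a)).
exists (\max_(l <- Z) e l)%N => l m lZ le_m.
apply: (idealX_leq (local_ideal_ideal f l) (m := e l)).
  by apply: leq_trans le_m; apply: leq_bigmax_seq.
exact: svalP (cid (local_ideal_radical f l a)).
Qed.

(** * The criterion for MZ-spaces *)

Local Open Scope fset_scope.

Theorem theorem1 (k : closedFieldType) (n : nat) (f : 'I_n -> {poly k})
    (g : {ffun 'I_n -> k} -> {mpoly k[n]}) (V : set {mpoly k[n]})
    (k_char0 : [pchar k] =i pred0)
    (f_monic : forall i, f i \is monic)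
    (f_deg : forall i, (1 < size (f i))%N)
    (f_zero : forall i, ~~ root (f i) 0)
    (g_idem : idempotent_reps f g)
    (V_sub : GRing.submod_closed (mem V))
    (I_sub_V : forall p, p \in univ_ideal f -> p \in V) :
  MZ_space V <->
  (forall L : {fset {ffun 'I_n -> k}}, {subset L <= zeros f} -> L != fset0 ->
     ([fset l in L | l \notin zeros_in f g V] != fset0 ->
        idempotent_sum g [fset l in L | l \notin zeros_in f g V] \notin V) /\
     (forall p : {mpoly k[n]},
        p * idempotent_sum g [fset l in L | l \in zeros_in f g V] \in V)).
Proof.
have [V0 V_lin] := V_sub.
have VD p q : p \in V -> q \in V -> (p + q)%R \in V.
  by move=> Vp Vq; rewrite -[p]scale1r; apply: V_lin.
have VB p q : p \in V -> q \in V -> (p - q)%R \in V.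
  by move=> Vp Vq; rewrite addrC -scaleN1r; apply: V_lin.
have V_cong p q : univ_ideal f (p - q) -> q \in V -> p \in V.
  by move=> Ipq Vq; rewrite -[p](subrK q); apply: VD => //; apply/I_sub_V/mem_set.
have I_ideal : is_ideal (univ_ideal f) by apply: ideal_span_ideal.
have I_sym p q : univ_ideal f (p - q) -> univ_ideal f (q - p).
  by move=> Ipq; rewrite -opprB -mulN1r; apply: idealMl.
split=> [[_ V_MZ]|V_cond].
  (* An idempotent sum in [V] has all its positive powers in [V], so the MZ property applies to it;
     [N.+1] keeps the exponent positive. *)
  have V_ideal (S : {fset {ffun 'I_n -> k}}) p : {subset S <= zeros f} ->
      idempotent_sum g S \in V -> (p * idempotent_sum g S)%R \in V.
    move=> S_zeros VeS; have IeX := idempotent_sumX f_monic f_deg g_idem S_zeros.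
    have [|N VN] := V_MZ (idempotent_sum g S) _ p.
      by exists 1%N => -[//|m] _; apply: V_cong VeS.
    apply: (V_cong _ (p * idempotent_sum g S ^+ N.+1)%R); last exact: VN.
    by rewrite -mulrBr; apply: idealMl => //; apply: I_sym.
  move=> L L_zeros _; split=> [/fset0Pn[l]|p].
    set S := [fset l in L | l \notin zeros_in f g V] => lS; apply/negP => VeS.
    have S_zeros : {subset S <= zeros f}.
      by move=> u; rewrite !inE => /andP[/L_zeros].
    have l0 := S_zeros l lS.
    have : l \notin zeros_in f g V by move: lS; rewrite !inE => /andP[].
    rewrite inE l0 => /negP; apply.
    (* For [l] in [S], [g l] is congruent to its product with the sum over [S], so it would lie in
       [V]. *)
    apply: (V_cong _ (g l * idempotent_sum g S)%R); last exact: V_ideal.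
    apply: mul_idempotent_sum => // u u0 uS; have [_ gl] := g_idem l l0.
    by have := gl u u0; rewrite in_setE; apply; apply: contraNneq uS => ->.
  rewrite /idempotent_sum mulr_sumr big_seq_cond.
  elim/big_rec: _ => // l q lS Vq; apply: VD => //.
  have [l0 Vgl] : l \in zeros f /\ g l \in V.
    by apply/andP; move: lS; rewrite andbT in_fset => /andP[].
  have := @V_ideal [fset l] p.
  by rewrite /idempotent_sum big_seq_fset1; apply => // u; rewrite inE => /eqP->.
split=> // a [N Va] b.
have [Z def_Z] := zeros_fset f_monic.
have [M M_local] := uniform_radical_exponent f a Z.
(* The components in which [a] is invertible. *)
pose S := [fset l in Z | a.@[l] != 0].
have S_def l : (l \in S) = (l \in zeros f) && (a.@[l] != 0).
  by rewrite !inE /= def_Z.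
have S_zeros : {subset S <= zeros f} by move=> l; rewrite S_def => /andP[].
have VeS : idempotent_sum g S \in V.
  (* Exponents from [N] on keep the powers of [a] in [V]; those from [M] on kill the nilpotent
     parts. *)
  have [l l0|u Iu] := idempotent_sum_powers (N := maxn N M) f_monic f_deg g_idem S_def.
    by apply: M_local; rewrite ?def_Z ?leq_maxr.
  apply: (V_cong _ _ (I_sym _ _ Iu)); apply: horner_alg_mulXn => // m.
  by rewrite geq_max => /andP[/Va].
have VeS_ideal p : (p * idempotent_sum g S)%R \in V.
  have [->|S_neq0] := eqVneq S fset0.
    by rewrite /idempotent_sum big_seq_fset0 mulr0.
  have [S2_notin S1_ideal] := V_cond S S_zeros S_neq0.
  suff -> : S = [fset l in S | l \in zeros_in f g V] by [].
  (* By (ii) with factor 1, the sum over the zeros of [S] with [g l] in [V] lies in [V]; so does the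
     complementary sum, which (i) forbids unless it is empty. *)
  have S2_eq0 : [fset l in S | l \notin zeros_in f g V] = fset0.
    apply/eqP; apply: contraT => /S2_notin/negP; case.
    have -> : idempotent_sum g [fset l in S | l \notin zeros_in f g V] =
        (idempotent_sum g S -
          1 * idempotent_sum g [fset l in S | l \in zeros_in f g V])%R.
      rewrite mul1r; apply/eqP; rewrite eq_sym subr_eq addrC; apply/eqP.
      rewrite /idempotent_sum (big_fsetID _ (zeros_in f g V)) /=.
      by congr (_ + _)%R; apply: eq_fbigl => l; rewrite !in_fset.
    exact: VB.
  apply/fsetP => l; rewrite !inE; have := in_fset0 l; rewrite -S2_eq0 !inE.
  by case: (l \in Z) => //=; case: (_ != 0) => //= /negbFE.
(* Beyond [M], [a ^+ m] vanishes off [S], so multiplying [b * a ^+ m] by the idempotent does not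
   change its class. *)
exists M.+1 => m lt_Mm.
apply: (V_cong _ ((b * a ^+ m) * idempotent_sum g S)%R); last exact: VeS_ideal.
apply: mul_idempotent_sum => // l l0; rewrite S_def l0 /= negbK => /eqP al0.
have := M_local l m; rewrite def_Z al0 subr0 => /(_ l0 (ltnW lt_Mm)).
by apply: idealMl; apply: local_ideal_ideal.
Qed.
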